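(* Let $G$ be a connected non-complete graph on $[n]=\{1,\dots,n\}$ such that $d(G)+f(G)+1=n+2-\kappa(G)$. (1) If $\kappa(G)=1$, then either $G$ is chordal, or $G$ has precisely one induced cycle of length $4$ and has no induced cycle of length $l$ for any $l\ge 5$. (2) If $\kappa(G)\ge 2$ and $d(G)=2$, then $G$ is chordal. (3) If $\kappa(G)=2$ and $d(G)=3$, then either $G$ is chordal, or $G$ has precisely one induced cycle of length $4$ and has no induced cycle of length $l$ for any $l\ge 5$.
   Context: All graphs are finite and simple. For a connected graph $G$: $d(G)$ is the diameter, i.e. the maximum over pairs of vertices of the number of edges in a shortest path between them. A vertex is simplicial if it is contained in exactly one maximal clique (equivalently, its neighbors are pairwise adjacent); $f(G)$ is the number of simplicial vertices. For non-complete $G$, the vertex connectivity is $\kappa(G)=\min\{|T| : T\subset V(G),\ \text{the induced subgraph on } V(G)\setminus T \text{ is disconnected}\}$. A graph is chordal if every induced cycle has length $3$. *)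

(* Defs.v *)
From HB Require Import structures.
From mathcomp Require Import all_boot.

Set Implicit Arguments.
Unset Strict Implicit.
Unset Printing Implicit Defensive.

(* A finite simple graph is a finite type of vertices with a symmetric and
   irreflexive adjacency relation [e]; the theorem assumes both properties
   explicitly, the definitions below do not need them. *)
Section Graphs.

Variables (T : finType) (e : rel T).

Definition complete : bool := [forall x, forall y, (x != y) ==> e x y].

Definition induced (S : {set T}) : rel T :=
  [rel x y | [&& x \in S, y \in S & e x y]].

(* Connectedness of the subgraph induced on [S]; the empty set counts as
   connected. *)
Definition connected_on (S : {set T}) : bool :=
  [forall x in S, forall y in S, connect (induced S) x y].

Definition connected : bool := connected_on [set: T].

Definition has_walk (x y : T) (k : nat) : bool :=
  [exists p : k.-tuple T, path e x p && (last x p == y)].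

(* Shortest paths have fewer than [#|T|] edges, so the default value [#|T|] is
   only taken when there is no walk from [x] to [y]. *)
Definition dist (x y : T) : nat :=
  \big[minn/#|T|]_(k < #|T| | has_walk x y k) k.

Definition diameter : nat := \max_(x : T) \max_(y : T) dist x y.

Definition clique (C : {set T}) : bool :=
  [forall x in C, forall y in C, (x != y) ==> e x y].

Definition simplicial (x : T) : bool :=
  #|[set C : {set T} | maxset clique C & x \in C]| == 1.

Definition num_simplicial : nat := #|[set x | simplicial x]|.

(* The default value [#|T|] is only taken when no vertex set disconnects the
   graph, that is, when the graph is complete. *)
Definition vertex_connectivity : nat :=
  \big[minn/#|T|]_(S : {set T} | ~~ connected_on (~: S)) #|S|.

(* An induced cycle is identified with its vertex set [S]: the vertices of [S]
   can be listed cyclically as [c], without repetition, so that two of them are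
   adjacent exactly when they are consecutive in [c]. *)
Definition induced_cycle (l : nat) (S : {set T}) : bool :=
  (2 < l) &&
  [exists c : l.-tuple T,
    [&& uniq c, S == [set x in c] &
        [forall x in S, forall y in S,
           e x y == (next c x == y) || (next c y == x)]]].

Definition chordal : Prop :=
  forall (l : nat) (S : {set T}), induced_cycle l S -> l = 3.

Definition one_induced_C4_only : Prop :=
  #|[set S : {set T} | induced_cycle 4 S]| = 1 /\
  forall (l : nat) (S : {set T}), 5 <= l -> ~~ induced_cycle l S.

End Graphs.

(* Main.v *)
Require Import Defs.
From HB Require Import structures.
From mathcomp Require Import all_boot.
From mathcomp Require Import zify.

(** Write [N] for the set of non-simplicial vertices, [d] for the diameter and
    [k] for the vertex connectivity.  As [f = n - #|N|], the hypothesis says that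
    [#|N| = d + k - 1], so that [N] is nearly as small as it can be; on the other
    hand every vertex of an induced cycle of length at least 4 has two
    non-adjacent neighbours, so that such a cycle lives inside [N]
    ([induced_cycle_nonsimplicial]).

    If [k = 2] and [d = 3], then [#|N| = 4], and the only set that can carry an
    induced cycle of length at least 4 is [N] itself.

    If [d = 2], then [#|N| = k + 1].  Two non-adjacent vertices [a], [b] are
    separated by [N] minus [a] and [b], because the interior of an induced path
    between them lies in [N] ([nonsimplicial_separates]).  When [a] and [b] are in
    [N], as two vertices of a long induced cycle would be, this gives
    [k <= #|N| - 2], which is absurd ([few_nonsimplicial_chordal]).

    If [k = 1], then [#|N| = d].  The [d - 1] interior vertices of a shortest path
    that realizes the diameter are in [N] ([geodesic_levels]), so that [N] is this
    interior [V] plus a single vertex [w].  On [V], the distance [h] to the start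
    of the path is injective, and [h] changes by at most 1 along an edge.  The
    lowest and the highest vertex of [V] on an induced cycle must then both be
    neighbours of [w], which leaves room for three levels only: the cycle has
    length 4, and consists of [w] and the vertices of [V] on the levels from
    [h w - 1] to [h w + 1] ([induced_cycle_levels]). *)
Set Implicit Arguments.
Unset Strict Implicit.
Unset Printing Implicit Defensive.

(** * Iterated minima with a default value *)

Lemma bigmin_leq_cond (I : finType) (n : nat) (P : pred I) (F : I -> nat) j :
  P j -> \big[minn/n]_(i | P i) F i <= F j.
Proof.
move=> Pj; have := mem_index_enum j.
elim: (index_enum I) => // i r IHr; rewrite inE big_cons => /orP[/eqP<- | /IHr].
  by rewrite Pj geq_minl.
by case: ifP => // _; apply: leq_trans; rewrite geq_minr.
Qed.

Lemma bigmin_attained (I : finType) (n : nat) (P : pred I) (F : I -> nat) :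
  \big[minn/n]_(i | P i) F i < n ->
  exists2 j, P j & \big[minn/n]_(i | P i) F i = F j.
Proof.
suff [-> | //] : \big[minn/n]_(i | P i) F i = n \/
    exists2 j, P j & \big[minn/n]_(i | P i) F i = F j by rewrite ltnn.
apply: (big_ind (fun m => m = n \/ exists2 j, P j & m = F j)); first by left.
  by move=> a b Ha Hb; rewrite /minn; case: ifP.
by move=> i Pi; right; exists i.
Qed.

Section Graph.

Variables (T : finType) (e : rel T).
Hypotheses (e_sym : symmetric e) (e_irr : irreflexive e).

Implicit Types (x y z u v : T) (S : {set T}).

(** * Walks and distances *)

Lemma has_walkP x y k :
  reflect (exists p, [/\ path e x p, last x p = y & size p = k])
          (has_walk e x y k).
Proof.
apply: (iffP existsP) => [[p /andP[xp /eqP py]] | [p [xp py <-]]].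
  by exists p; rewrite size_tuple.
by exists (in_tuple p); rewrite xp /= py eqxx.
Qed.

Lemma dist_leq x y k : has_walk e x y k -> dist e x y <= k.
Proof.
rewrite /dist => xyk; have [k_small | k_big] := ltnP k #|T|.
  exact: (@bigmin_leq_cond _ _ (fun k : 'I__ => has_walk e x y k)
            (@nat_of_ord _) (Ordinal k_small)).
apply: leq_trans k_big; elim/big_ind: _ => // [a b a_le _ | i _].
  by rewrite geq_min a_le.
exact: ltnW.
Qed.

(** Shortening a walk to a duplicate-free one makes it shorter than [#|T|], so
    that the default value of [dist] is out of play. *)
Lemma dist_walk x y : connected e -> has_walk e x y (dist e x y).
Proof.
move=> /forallP/(_ x)/implyP/(_ (in_setT x)).
move=> /forallP/(_ y)/implyP/(_ (in_setT y)) /connectP[p xp ->].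
have {}xp : path e x p.
  by apply: sub_path xp => u v /and3P[].
case/shortenP: xp => q xq q_uniq _.
have q_walk : has_walk e x (last x q) (size q) by apply/has_walkP; exists q.
have q_small : size q < #|T|.
  by have := max_card [in x :: q]; rewrite (card_uniqP q_uniq).
have [k q_k dist_k] := bigmin_attained (leq_ltn_trans (dist_leq q_walk) q_small).
by rewrite /dist dist_k.
Qed.

Lemma dist_triangle x y z :
  connected e -> dist e x z <= dist e x y + dist e y z.
Proof.
move=> conn; have /has_walkP[p [xp py <-]] := dist_walk x y conn.
have /has_walkP[q [yq qz <-]] := dist_walk y z conn.
apply/dist_leq/has_walkP; exists (p ++ q).
by rewrite cat_path last_cat py xp yq qz size_cat.
Qed.

Lemma dist_edge x u v : connected e -> e u v -> dist e x v <= (dist e x u).+1.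
Proof.
move=> conn uv; apply: leq_trans (dist_triangle x u v conn) _.
rewrite -addn1 leq_add2l; apply/dist_leq/has_walkP.
by exists [:: v]; rewrite /= uv.
Qed.

Lemma diameter_gt0 x y : connected e -> x != y -> 0 < diameter e.
Proof.
move=> conn xy; have : dist e x y <= diameter e.
  exact: leq_trans (leq_bigmax y) (leq_bigmax (F := fun x => \max_y dist e x y) x).
apply: leq_trans; have /has_walkP[[|z p] [_ xy_last <-]] // := dist_walk x y conn.
by rewrite -xy_last eqxx in xy.
Qed.

(** A vertex nearer to [x] than its position would give a shortcut to the end of
    the path. *)
Lemma dist_geodesic x p i : connected e -> path e x p ->
  dist e x (last x p) = size p -> i <= size p ->
  dist e x (nth x (x :: p) i) = i.
Proof.
move=> conn xp p_geo i_le; have sz_i : size (take i p) = i by rewrite size_takel.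
have nth_i : nth x (x :: p) i = last x (take i p).
  rewrite (last_nth x) sz_i -{1}(cat_take_drop i p) -cat_cons nth_cat /= sz_i.
  by rewrite ltnS leqnn.
rewrite nth_i; apply/eqP; rewrite eqn_leq; apply/andP.
move: xp; rewrite -{1}(cat_take_drop i p) cat_path => /andP[x_take take_drop].
split; first by apply/dist_leq/has_walkP; exists (take i p).
have := dist_triangle x (last x (take i p)) (last x p) conn.
have : dist e (last x (take i p)) (last x p) <= size p - i.
  apply/dist_leq/has_walkP; exists (drop i p).
  by rewrite -last_cat cat_take_drop size_drop.
by rewrite p_geo; lia.
Qed.

(** * Non-simplicial vertices *)

(** The edges from [x] to [u] and to [v] extend to maximal cliques through [x], and
    there is just one of these. *)
Lemma simplicial_nbrs x u v :
  simplicial e x -> e x u -> e x v -> u != v -> e u v.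
Proof.
have edge_clique y : e x y -> clique e [set x; y].
  move=> xy; apply/forallP => a; apply/implyP; rewrite !inE => ha.
  apply/forallP => b; apply/implyP; rewrite !inE => hb; apply/implyP.
  by case/pred2P: ha => ->; case/pred2P: hb => ->; rewrite ?eqxx // e_sym.
rewrite /simplicial => /cards1P[C maxC] xu xv uv.
have inC y : e x y -> y \in C.
  move=> /edge_clique/maxset_exists[D maxD /subsetP xyD].
  have : D \in [set D | maxset (clique e) D & x \in D].
    by rewrite inE maxD xyD // !inE eqxx.
  by rewrite maxC inE => /eqP<-; rewrite xyD // !inE eqxx orbT.
have : C \in [set D | maxset (clique e) D & x \in D] by rewrite maxC inE.
rewrite inE => /andP[/maxsetp/forallP/(_ u)/implyP/(_ (inC u xu)) + _].
by move=> /forallP/(_ v)/implyP/(_ (inC v xv)); rewrite uv.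
Qed.

Definition nonsimplicial : {set T} := ~: [set x | simplicial e x].

Lemma nonsimplicial_nbrs x u v :
  e x u -> e x v -> u != v -> ~~ e u v -> x \in nonsimplicial.
Proof.
move=> xu xv uv; rewrite !inE; apply: contra => x_simp.
exact: simplicial_nbrs x_simp xu xv uv.
Qed.

Lemma vertex_connectivity_leq S :
  ~~ connected_on e (~: S) -> vertex_connectivity e <= #|S|.
Proof.
exact: (@bigmin_leq_cond _ _ (fun S => ~~ connected_on e (~: S)) (fun S => #|S|)).
Qed.

(** A walk that starts at [a] and whose vertices other than [a] and [b] are all
    simplicial never leaves the closed neighbourhood of [a]: its next vertex is
    adjacent to [a] by [simplicial_nbrs].  Hence it cannot reach [b]. *)
Lemma nonsimplicial_separates a b : a != b -> ~~ e a b ->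
  vertex_connectivity e <= #|nonsimplicial :\: [set a; b]|.
Proof.
move=> ab nab; apply: vertex_connectivity_leq; apply/negP.
set D := ~: _ => D_conn.
have aD : a \in D by rewrite !inE eqxx.
have bD : b \in D by rewrite !inE eqxx orbT.
have /connectP[p ap b_last] : connect (induced e D) a b.
  move/forallP/(_ a)/implyP/(_ aD): D_conn.
  by move/forallP/(_ b)/implyP/(_ bD).
suff star q c : (c == a) || e a c -> path (induced e D) c q ->
    (last c q == a) || e a (last c q).
  have := star p a; rewrite -b_last eqxx eq_sym (negbTE ab) (negbTE nab).
  by move=> /(_ isT ap).
elim: q c => //= z q IHq c ac /andP[/and3P[cD _ cz] zq]; apply: IHq zq.
have [-> // | za /=] := eqVneq z a.
have [c_a | ca] := eqVneq c a; first by rewrite -c_a.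
move: ac; rewrite (negbTE ca) /= => ac.
apply: (simplicial_nbrs (x := c)); rewrite // 1?e_sym // 1?eq_sym //.
move: cD; rewrite !inE (negbTE ca) /= negb_and !negbK.
by case/orP=> // /eqP c_b; rewrite -c_b ac in nab.
Qed.

(** * Induced cycles of length at least 4 *)

Lemma induced_cycle_card l S : induced_cycle e l S -> #|S| = l.
Proof.
case/andP=> _ /existsP[c /and3P[c_uniq /eqP-> _]].
by rewrite cardsE (card_uniqP c_uniq) size_tuple.
Qed.

(** The two neighbours are those in the cyclic order: were they equal or adjacent,
    then turning around the cycle by 2, 1 or 3 steps would fix a vertex. *)
Lemma induced_cycle_nbrs l S x : 3 < l -> induced_cycle e l S -> x \in S ->
  exists u v, [/\ u \in S, v \in S, e x u, e x v & u != v /\ ~~ e u v].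
Proof.
move=> l_gt3 /andP[_ /existsP[c /and3P[c_uniq /eqP-> /forallP adj]]].
have {}adj u v : u \in c -> v \in c ->
    e u v = (next c u == v) || (next c v == u).
  move=> uc vc; apply/eqP; have := adj u; rewrite inE uc => /forallP/(_ v).
  by rewrite inE vc.
have iter_neq k u : u \in c -> 0 < k < 4 -> iter k (next c) u != u.
  move=> uc /andP[k_gt0 k_lt4]; apply/eqP=> u_k.
  have u_ord : order (next c) u = l.
    by rewrite (order_cycle (cycle_next c_uniq) c_uniq uc) size_tuple.
  have := @findex_iter _ (next c) u k; rewrite u_k findex0 u_ord => k0.
  by rewrite -k0 ?(leq_trans k_lt4) in k_gt0.
rewrite inE => xc; set u := prev c x.
have uc : u \in c by rewrite mem_prev.
have x_next : x = next c u by rewrite next_prev.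
have vc : next c x \in c by rewrite mem_next.
exists u, (next c x); rewrite !inE uc vc !adj // -x_next !eqxx orbT.
split=> //; rewrite eq_sym negb_or [x == _]eq_sym.
by rewrite (iter_neq 1 x) // x_next (iter_neq 2 u) // (iter_neq 3 u).
Qed.

Lemma induced_cycle_nonsimplicial l S :
  3 < l -> induced_cycle e l S -> S \subset nonsimplicial.
Proof.
move=> l_gt3 S_cyc; apply/subsetP=> x xS.
have [u [v [_ _ xu xv [uv nuv]]]] := induced_cycle_nbrs l_gt3 S_cyc xS.
exact: nonsimplicial_nbrs xu xv uv nuv.
Qed.

Lemma few_nonsimplicial_chordal :
  #|nonsimplicial| < vertex_connectivity e + 2 -> chordal e.
Proof.
move=> N_small l S S_cyc; have [l_le3 | l_gt3] := leqP l 3.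
  by have /andP[] := S_cyc; lia.
have /subsetP S_sub := induced_cycle_nonsimplicial l_gt3 S_cyc.
have [x xS] : exists x, x \in S.
  by apply/card_gt0P; rewrite (induced_cycle_card S_cyc); lia.
have [u [v [uS vS _ _ [uv nuv]]]] := induced_cycle_nbrs l_gt3 S_cyc xS.
have uvN : [set u; v] \subset nonsimplicial by rewrite subUset !sub1set !S_sub.
have := subset_leq_card uvN; have := nonsimplicial_separates uv nuv.
by rewrite cardsDS // cards2 uv /=; lia.
Qed.

(** * Cycles made of a geodesic and one more vertex *)

Lemma card_level_set (h : T -> nat) (V : {set T}) m k : {in V &, injective h} ->
  #|[set v in V | m <= h v < m + k]| <= k.
Proof.
move=> h_inj; set A := [set v in V | _].
rewrite -(size_iota m k) cardE -(size_map h); apply: uniq_leq_size.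
  rewrite map_inj_in_uniq ?enum_uniq // => u v.
  by rewrite !mem_enum !inE => /andP[uV _] /andP[vV _]; apply: h_inj.
move=> i /mapP[v]; rewrite mem_enum inE => /andP[_ v_lev] ->.
by rewrite mem_iota.
Qed.

(** Think of [h] as the distance to one end of a geodesic with interior [V].  As the
    conclusion determines [S] from [h], [V] and [w], it bounds both the length
    and the number of the induced cycles inside [w |: V]. *)
Lemma induced_cycle_levels (h : T -> nat) (V : {set T}) w l S :
    (forall u v, e u v -> h v <= (h u).+1) -> {in V &, injective h} ->
    3 < l -> induced_cycle e l S -> S \subset w |: V ->
  l = 4 /\ S = w |: [set v in V | h w <= (h v).+1 <= (h w).+2].
Proof.
move=> h_lip h_inj l_gt3 S_cyc /subsetP S_sub.
have inV v : v \in S -> v != w -> v \in V.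
  by move=> /S_sub; rewrite !inE => /predU1P[-> | //]; rewrite eqxx.
have S_card := induced_cycle_card S_cyc.
have [v0 v0S v0w] : exists2 v, v \in S & v != w.
  have : 0 < #|S :\ w| by have := cardsD1 w S; lia.
  by case/card_gt0P=> v; rewrite !inE => /andP[]; exists v.
have Pv0 : v0 \in S :\ w by rewrite !inE v0w.
(* By injectivity of [h], only one neighbour of [a] on the cycle can be in [V] when
   the level of such neighbours is prescribed; the other one is then [w]. *)
have adj_w a (k : nat) : a \in S :\ w ->
    (forall v, v \in S :\ w -> e a v -> h v = k) -> e a w /\ w \in S.
  rewrite !inE => /andP[aw aS] a_nbrs.
  have [u [v [uS vS au av [uv _]]]] := induced_cycle_nbrs l_gt3 S_cyc aS.
  have [<- // | uw] := eqVneq u w; have [<- // | vw] := eqVneq v w.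
  case/eqP: uv; apply: h_inj; rewrite ?inV //.
  by rewrite !a_nbrs // !inE ?uw ?vw.
have edge_neq u v : u \in S :\ w -> v \in S :\ w -> e u v -> h u <> h v.
  rewrite !inE => /andP[uw uS] /andP[vw vS] uv huv.
  by have u_v : u = v; [apply: h_inj; rewrite ?inV | rewrite u_v e_irr in uv].
have [a aSw a_min] := arg_minnP h Pv0; have [b bSw b_max] := arg_maxnP h Pv0.
have [aw wS] : e a w /\ w \in S.
  apply: (adj_w a (h a).+1) => // v vSw av.
  have := a_min v vSw; have := h_lip a v av; have := edge_neq a v aSw vSw av.
  by lia.
have [bw _] : e b w /\ w \in S.
  apply: (adj_w b (h b).-1) => // v vSw bv.
  have vb : e v b by rewrite e_sym.
  have := b_max v vSw; have := h_lip v b vb; have := edge_neq b v bSw vSw bv.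
  by lia.
have wa : e w a by rewrite e_sym.
have wb : e w b by rewrite e_sym.
(* [w] is adjacent to a vertex on the lowest level and to one on the highest, so
   that all levels lie between [h w - 1] and [h w + 1]. *)
have ha := h_lip a w aw; have hb := h_lip w b wb.
set A := [set v in V | _].
have A_card : #|A| <= 3.
  apply: leq_trans (card_level_set (h w).-1 3 h_inj); apply: subset_leq_card.
  apply/subsetP=> v; rewrite !inE => /andP[-> /=]; lia.
have SA : S :\ w \subset A.
  apply/subsetP=> v vSw; have av := a_min v vSw; have vb := b_max v vSw.
  move: vSw; rewrite !inE => /andP[vw vS]; rewrite inV //=; lia.
have Sw_card : #|S| = (#|S :\ w|).+1 by rewrite (cardsD1 w S) wS.
(* The cycle has at least 3 vertices besides [w], so that it fills [A]. *)
have {}SA : S :\ w = A by apply/eqP; rewrite eqEcard SA; lia.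
split; last by rewrite -SA setD1K.
by rewrite -S_card Sw_card SA; move: Sw_card; rewrite SA; lia.
Qed.

(** The interior of a geodesic that realizes the diameter: each of its vertices has
    neighbours at distances from [x] that differ by 2, hence non-adjacent ones. *)
Lemma geodesic_levels : 0 < #|T| -> connected e ->
  exists x (V : {set T}),
    [/\ {in V &, injective (dist e x)}, V \subset nonsimplicial &
        #|V| = (diameter e).-1].
Proof.
move=> T_gt0 conn.
have [x x_diam] := eq_bigmax (fun x => \max_(y : T) dist e x y) T_gt0.
have [y y_diam] := eq_bigmax (dist e x) T_gt0.
have d_xy : diameter e = dist e x y by rewrite /diameter x_diam y_diam.
have /has_walkP[p [xp py p_size]] := dist_walk x y conn.
have lev i : i <= size p -> dist e x (nth x (x :: p) i) = i.
  by apply: dist_geodesic => //; rewrite py.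
pose v (i : 'I_(size p).-1) := nth x (x :: p) i.+1.
have v_lev i : dist e x (v i) = i.+1 by rewrite lev //; case: i => i /=; lia.
exists x, [set v i | i : 'I_(size p).-1]; split.
- by move=> _ _ /imsetP[i _ ->] /imsetP[j _ ->]; rewrite !v_lev => -[] /val_inj->.
- apply/subsetP=> _ /imsetP[[i i_lt] _ ->]; rewrite /v /=.
  have edge j : j < size p -> e (nth x (x :: p) j) (nth x (x :: p) j.+1).
    by move=> j_lt; apply: (pathP x xp).
  have li := lev i; have li2 := lev i.+2.
  apply: (@nonsimplicial_nbrs _ (nth x (x :: p) i) (nth x (x :: p) i.+2)).
  + by rewrite e_sym; apply: (edge i); lia.
  + by apply: (edge i.+1); lia.
  + by apply/eqP=> eq_i; rewrite eq_i in li; lia.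
  + by apply/negP=> /(dist_edge x conn); lia.
- rewrite card_imset ?card_ord ?d_xy ?p_size // => i j /(congr1 (dist e x)).
  by rewrite !v_lev => -[] /val_inj.
Qed.

(** * The dichotomy *)

(** In both cases with two outcomes there is a single candidate [S0] for the vertex
    set of a long induced cycle; whether it carries one decides the outcome. *)
Lemma chordal_or_one_C4 S0 :
  (forall l S, 3 < l -> induced_cycle e l S -> l = 4 /\ S = S0) ->
  chordal e \/ one_induced_C4_only e.
Proof.
move=> S0_only; have [S0_cyc | S0_ncyc] := boolP (induced_cycle e 4 S0).
  right; split=> [|l S l_ge5].
    rewrite (_ : [set S | _] = [set S0]) ?cards1 //; apply/setP=> S.
    rewrite !inE; apply/idP/eqP=> [S_cyc | -> //].
    by have [] := S0_only 4 S isT S_cyc.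
  by apply/negP=> S_cyc; have [l4 _] := S0_only l S (ltnW l_ge5) S_cyc; lia.
left=> l S S_cyc; have [l_le3 | l_gt3] := leqP l 3.
  by have /andP[] := S_cyc; lia.
have [l4 S_S0] := S0_only l S l_gt3 S_cyc.
by rewrite -S_S0 -l4 S_cyc in S0_ncyc.
Qed.

End Graph.

Theorem theorem3p8 (n : nat) (e : rel 'I_n)
    (e_sym : symmetric e) (e_irr : irreflexive e)
    (e_conn : connected e) (e_ncomp : ~~ complete e)
    (e_eq : diameter e + num_simplicial e + 1 = n + 2 - vertex_connectivity e) :
  [/\ vertex_connectivity e = 1 -> chordal e \/ one_induced_C4_only e,
      2 <= vertex_connectivity e -> diameter e = 2 -> chordal e
    & vertex_connectivity e = 2 -> diameter e = 3 ->
        chordal e \/ one_induced_C4_only e].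
Proof.
have n_gt0 : 0 < #|'I_n|.
  by case/forallPn: e_ncomp => x _; apply/card_gt0P; exists x.
(* The left-hand side of [e_eq] is positive, so that the subtraction in it is not
   truncated. *)
have N_card : #|nonsimplicial e| + 1 = diameter e + vertex_connectivity e.
  have := cardsC [set x | simplicial e x]; rewrite -/(nonsimplicial e) card_ord.
  by rewrite -/(num_simplicial e); lia.
split=> [k1 | k2 d2 | k2 d3].
- have [x [V [V_inj V_sub V_card]]] := geodesic_levels e_sym n_gt0 e_conn.
  have d_gt0 : 0 < diameter e.
    have [a /forallPn[b]] := forallPn e_ncomp; rewrite negb_imply => /andP[ab _].
    exact: diameter_gt0 ab.
  have /cards1P[w w_rest] : #|nonsimplicial e :\: V| == 1.
    by rewrite cardsDS //; lia.
  apply: chordal_or_one_C4 => l S l_gt3 S_cyc.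
  apply: (induced_cycle_levels (w := w) e_sym e_irr _ V_inj l_gt3 S_cyc).
    by move=> u v; apply: dist_edge.
  apply: subset_trans (induced_cycle_nonsimplicial e_sym l_gt3 S_cyc) _.
  by rewrite setUC -w_rest -subDset.
- by apply: few_nonsimplicial_chordal => //; lia.
- apply: (@chordal_or_one_C4 _ _ (nonsimplicial e)) => l S l_gt3 S_cyc.
  have S_sub := induced_cycle_nonsimplicial e_sym l_gt3 S_cyc.
  have S_card := induced_cycle_card S_cyc.
  have S_N : S = nonsimplicial e by apply/eqP; rewrite eqEcard S_sub; lia.
  by rewrite -S_card S_N; split=> //; lia.
Qed.
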